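(* Let $T_n$ be the tree with $4n-2$ vertices obtained from the path with vertices $v_1,\dots,v_{3n-2}$ (edges $v_jv_{j+1}$) by adding vertices $w_1,\dots,w_n$, where $w_i$ is adjacent only to $v_{3i-2}$. Then $\lim_{n\to\infty}\mathcal{I}(T_n)=\frac{13}{18}$.
   Context: For a finite simple graph $G$: a matching is a set of pairwise vertex-disjoint edges; it is maximal if not contained in a larger matching. $\nu(G)$ is the maximum matching size, $\mathcal{T}_0(G)$ the number of maximal matchings, $\mathcal{T}_1(G)$ the sum of the sizes of all maximal matchings, and $\mathcal{I}(G)=\frac{\mathcal{T}_1(G)}{\nu(G)\mathcal{T}_0(G)}$ (equal to $1$ by convention if $\nu(G)=0$). *)

(* Defs.v *)
From mathcomp Require Import all_boot all_order all_algebra.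
From mathcomp Require Import reals zify.

Set Implicit Arguments.
Unset Strict Implicit.
Unset Printing Implicit Defensive.

Import Order.TTheory GRing.Theory Num.Theory.

Record sgraph := SGraph {
  svertex :> finType;
  sedge : rel svertex;
  sedge_sym : symmetric sedge;
  sedge_irr : irreflexive sedge
}.

Section Matchings.
Variable G : sgraph.

Definition edges : {set {set G}} :=
  [set [set p.1; p.2] | p in [set p : G * G | sedge p.1 p.2]].

Definition matching (M : {set {set G}}) : bool :=
  (M \subset edges) && trivIset M.

Definition maximal_matching (M : {set {set G}}) : bool :=
  maxset matching M.

Definition matching_number : nat :=
  \max_(M : {set {set G}} | matching M) #|M|.

Definition nb_maximal_matchings : nat :=
  #|[set M : {set {set G}} | maximal_matching M]|.

Definition sum_maximal_matchings : nat :=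
  \sum_(M : {set {set G}} | maximal_matching M) #|M|.

Definition matching_ratio (R : realType) : R :=
  if matching_number == 0 then 1%R
  else (sum_maximal_matchings%:R /
        (matching_number%:R * nb_maximal_matchings%:R))%R.

End Matchings.

(* Indices are shifted to start at 0: [inl j] is the path vertex v_{j+1} and
   [inr i] is w_{i+1}, whose only neighbour is v_{3(i+1)-2} = [inl (3 * i)].
   For n = 0 the vertex type is empty. *)
Definition comb_rel (n : nat) : rel ('I_(3 * n - 2) + 'I_n)%type :=
  fun x y =>
  match x, y with
  | inl j, inl k => (j.+1 == k :> nat) || (k.+1 == j :> nat)
  | inl j, inr i => j == 3 * i :> nat
  | inr i, inl j => j == 3 * i :> nat
  | inr _, inr _ => false
  end.

Lemma comb_rel_sym n : symmetric (@comb_rel n).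
Proof. by move=> [j|i] [k|l] //=; rewrite orbC. Qed.

Lemma comb_rel_irr n : irreflexive (@comb_rel n).
Proof. by move=> [j|i] //=; rewrite orbb gtn_eqF. Qed.

Definition comb_tree (n : nat) : sgraph :=
  SGraph (@comb_rel_sym n) (@comb_rel_irr n).

Lemma card_comb_tree n : #|comb_tree n| = 4 * n - 2.
Proof. by rewrite card_sum !card_ord; lia. Qed.

(* Main.v *)
(** Call [v_{3i-2}] the [i]-th hub. A maximal matching covers every hub, since
    otherwise the pendant edge at that hub could be added; so each hub is matched
    to its pendant vertex, to the right, or to the left. These choices are
    arbitrary, except that the first hub has no left neighbour and the last one
    no right neighbour, and they determine the matching: between two consecutive
    hubs the middle edge is present exactly when the left hub is not matched to
    the right and the right hub is not matched to the left. Hence a maximal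
    matching has [n] edges at hubs plus the present middle edges, and averaging
    over the words gives probability [4/9] for an interior middle edge and [1/3]
    for the two extreme ones, so the mean size is [(13 n - 6) / 9] for [n >= 3].
    As [nu = 2 n - 1], the ratio equals [13/18 + 1 / (18 (2 n - 1))]. *)
Require Import Defs.
From mathcomp Require Import all_boot all_order all_algebra.
From mathcomp Require Import zify ring.

Set Implicit Arguments.
Unset Strict Implicit.
Unset Printing Implicit Defensive.

(** * Maximal matchings read through a labelling of the edges *)

Section Labelling.
Variables (G : sgraph) (I : finType) (lab : I -> {set G}).
Hypotheses (lab_inj : injective lab) (lab_edges : edges G = lab @: [set: I]).

(** Independent and dominating for the relation of sharing a vertex. A label meets itself, so the
    second clause also holds for members of [L]. *)
Definition maximal_packing (L : {set I}) : bool :=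
  [forall x in L, forall y in L, ~~ [disjoint lab x & lab y] ==> (x == y)] &&
  [forall x, exists y in L, ~~ [disjoint lab x & lab y]].

Lemma edge_card (e : {set G}) : e \in edges G -> #|e| = 2.
Proof.
case/imsetP=> -[x y]; rewrite inE /= => xy ->.
by rewrite cards2; case: eqVneq xy => // ->; rewrite sedge_irr.
Qed.

Lemma matching_card_bound (M : {set {set G}}) : matching M -> #|M| * 2 <= #|G|.
Proof.
case/andP=> /subsetP sM /eqP tM.
rewrite -sum_nat_const -(eq_bigr _ (fun e eM => edge_card (sM e eM))) tM.
exact: max_card.
Qed.

Lemma lab_self x : ~~ [disjoint lab x & lab x].
Proof.
have /edge_card : lab x \in edges G by rewrite lab_edges imset_f.
by rewrite -setI_eq0 setIid; case: eqVneq => // ->; rewrite cards0.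
Qed.

Lemma matching_labP (L : {set I}) :
  reflect {in L &, forall x y, ~~ [disjoint lab x & lab y] -> x = y}
    (matching (lab @: L)).
Proof.
rewrite /matching lab_edges imsetS ?subsetT //=.
apply: (iffP trivIsetP) => [tL x y xL yL|tL _ _ /imsetP[x xL ->] /imsetP[y yL ->]].
  by apply: contraNeq => xy; apply: tL; rewrite ?imset_f // (inj_eq lab_inj).
by apply: contraNT => /tL ->.
Qed.

Lemma maximal_matching_lab (L : {set I}) :
  maximal_matching (lab @: L) = maximal_packing L.
Proof.
apply/maxsetP/andP=> [[mL maxL]|[/forall_inP tL /forallP maxL]]; last first.
  have mL : matching (lab @: L).
    apply/matching_labP => x y xL yL xy.
    by have /forall_inP/(_ y yL)/implyP/(_ xy)/eqP := tL x xL.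
  split=> // N /andP[sN tN] sLN; apply/eqP; rewrite eqEsubset sLN andbT.
  apply/subsetP=> e eN; have := subsetP sN e eN; rewrite lab_edges.
  case/imsetP=> x _ def_e; have /exists_inP[y yL xy] := maxL x.
  have yN : lab y \in N by rewrite (subsetP sLN) ?imset_f.
  rewrite def_e; apply/imsetP; exists y => //; apply: contraNeq xy.
  by apply: (trivIsetP tN); rewrite -?def_e.
split; first by apply/forall_inP=> x xL; apply/forall_inP=> y yL; apply/implyP=> xy;
  apply/eqP; exact: (matching_labP _ mL).
(* A label meeting no member of [L] could be added, against maximality. *)
apply/forallP=> x; apply: contraT => /exists_inPn xL.
have /maxL : matching (lab @: (x |: L)).
  apply/matching_labP=> y z; rewrite !inE.
  case/predU1P=> [->|yL]; case/predU1P=> [->|zL] //.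
  - by rewrite (negbTE (xL z zL)).
  - by rewrite disjoint_sym (negbTE (xL y yL)).
  - exact: (matching_labP _ mL).
move/(_ (imsetS _ (subsetUr _ _)))/setP/(_ (lab x)).
rewrite imset_f ?setU11 // => /esym/imsetP[y yL /lab_inj xy].
by have := xL x; rewrite xy => /(_ yL); rewrite lab_self.
Qed.

(** With [F] arbitrary, one bijection serves both the count ([F] constant 1) and the sum of sizes
    ([F] the identity). *)
Lemma sum_maximal_matching (F : nat -> nat) :
  \sum_(M | @maximal_matching G M) F #|M| = \sum_(L | maximal_packing L) F #|L|.
Proof.
rewrite (reindex_onto (fun L : {set I} => lab @: L) (fun M => lab @^-1: M)) /=.
  apply: eq_big => [L|L _]; last by rewrite card_imset.
  rewrite maximal_matching_lab; apply/andb_idr => _; apply/eqP/setP=> x.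
  by rewrite inE (mem_imset _ _ lab_inj).
move=> M /maxsetP[/andP[/subsetP sM _] _]; apply/setP=> e.
apply/imsetP/idP=> [[x + ->]|eM]; first by rewrite inE.
have := sM _ eM; rewrite lab_edges => /imsetP[x _ ex].
by exists x; rewrite // inE -ex.
Qed.

End Labelling.

(** * Elementary counting *)

(** The weights are nine times the probabilities 1/3 and 4/9 of the middle edges; [0 < k] keeps the
    two extreme gaps distinct. *)
Lemma sum_gap_weights k : 0 < k ->
  \sum_(g < k.+1) (if (g == ord0) || (g == ord_max) then 3 else 4) = 2 + 4 * k.
Proof.
case: k => // k _; rewrite big_ord_recl big_ord_recr /= (eq_bigr (fun=> 4)).
  by rewrite sum_nat_const card_ord -!val_eqE /= /bump /= add1n eqxx; lia.
by move=> i _; rewrite -!val_eqE /= /bump /=; case: ifP => //; have := ltn_ord i; lia.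
Qed.

Lemma card_pointwise (n : nat) (T : finType) (Q : 'I_n -> pred T) :
  #|[pred s : {ffun 'I_n -> T} | [forall i, Q i (s i)]]| = \prod_i #|Q i|.
Proof.
by rewrite -[LHS]/(#|family Q|) card_family foldrE big_image.
Qed.

Lemma card_option_bool (P : pred (option bool)) :
  #|P| = P None + P (Some true) + P (Some false).
Proof.
rewrite -sum1_card big_mkcond (bigD1 None) //= (bigD1 (Some true)) //=.
rewrite (bigD1 (Some false)) //=.
by rewrite big1 => [|[[]|]] //; rewrite !unfold_in; do 3?case: (P _).
Qed.

(** * Edges of the comb tree and their conflicts *)

Section Comb.
Variable m : nat.
Let G := comb_tree m.+2.

(* [n = m + 2]. The label [inl (g, t)] is the path edge joining the 0-based path
   vertices [3g + t] and [3g + t + 1], so [t = 1] is the middle edge of the gap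
   between hubs [g] and [g + 1]; [inr i] is the pendant edge at hub [i]. *)
Definition comb_label : finType := (('I_m.+1 * 'I_3) + 'I_m.+2)%type.

Definition comb_edge (l : comb_label) : {set G} :=
  match l with
  | inl (g, t) =>
    [set x : G | if x is inl j then (j == 3 * g + t :> nat) || (j == (3 * g + t).+1 :> nat)
             else false]
  | inr i => [set x : G | match x with inl j => j == 3 * i :> nat | inr k => k == i end]
  end.

Definition comb_conflict (k l : comb_label) : bool :=
  match k, l with
  | inl (g, t), inl (g', t') =>
    (3 * g + t <= (3 * g' + t').+1) && (3 * g' + t' <= (3 * g + t).+1)
  | inl (g, t), inr i | inr i, inl (g, t) =>
    (3 * i == 3 * g + t) || (3 * i == (3 * g + t).+1)
  | inr i, inr j => i == j
  end.

Fact path_vertex_subproof j : j <= 3 * m.+1 -> j < 3 * m.+2 - 2.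
Proof. lia. Qed.

Definition path_vertex j (jm : j <= 3 * m.+1) : G :=
  inl (Ordinal (path_vertex_subproof jm)).

Lemma comb_conflictE k l :
  ~~ [disjoint comb_edge k & comb_edge l] = comb_conflict k l.
Proof.
apply/pred0Pn/idP => [[x]|].
  case: k l => [[g t]|i] [[g' t']|i'] /=; case: x => [j|j] //=; rewrite !inE //=; try lia.
    by rewrite -val_eqE /=; lia.
  by case/andP=> /eqP -> /eqP ->.
case: k l => [[g t]|i] [[g' t']|i'] /= kl.
(* Two path edges that meet share the larger of their left endpoints. *)
- have jm : maxn (3 * g + t) (3 * g' + t') <= 3 * m.+1.
    by have := ltn_ord g; have := ltn_ord g'; have := ltn_ord t; have := ltn_ord t'; lia.
  by exists (path_vertex jm); rewrite !inE /=; lia.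
- have jm : 3 * i' <= 3 * m.+1 by have := ltn_ord i'; lia.
  by exists (path_vertex jm); rewrite !inE /=; lia.
- have jm : 3 * i <= 3 * m.+1 by have := ltn_ord i; lia.
  by exists (path_vertex jm); rewrite !inE /=; lia.
- by exists (inr i); rewrite !inE /= eqxx.
Qed.

Lemma comb_edge_inj : injective comb_edge.
Proof.
move=> [[g t]|i] [[g' t']|i'] /setP E.
- have jm1 : 3 * g + t <= 3 * m.+1 by have := ltn_ord g; have := ltn_ord t; lia.
  have jm2 : (3 * g + t).+1 <= 3 * m.+1 by have := ltn_ord g; have := ltn_ord t; lia.
  have := E (path_vertex jm1); have := E (path_vertex jm2); rewrite !inE /= => e1 e2.
  have := ltn_ord t; have := ltn_ord t' => lt lt'.
  have gg : g = g' by apply: val_inj => /=; lia.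
  by rewrite gg in e1 e2 *; congr (inl (_, _)); apply: val_inj => /=; lia.
- by have := E (inr i'); rewrite !inE eqxx.
- by have := E (inr i); rewrite !inE eqxx.
- by have := E (inr i); rewrite !inE eqxx => /esym/eqP ->.
Qed.

Lemma edges_comb : edges G = comb_edge @: [set: comb_label].
Proof.
have gap (j k : 'I_(3 * m.+2 - 2)) : j.+1 = k :> nat ->
    [set inl j; inl k] \in comb_edge @: [set: comb_label].
  move=> jk; have lk := ltn_ord k.
  (* Division by 3 of the left endpoint gives the gap and the position in it. *)
  have lg : j %/ 3 < m.+1 by lia.
  have lt : j %% 3 < 3 by lia.
  apply/imsetP; exists (inl (Ordinal lg, Ordinal lt)) => //; apply/setP=> -[l|l].
    by rewrite !inE /= !(inj_eq (@inl_inj _ _)) -!val_eqE /=; lia.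
  by rewrite !inE.
have pend (j : 'I_(3 * m.+2 - 2)) (i : 'I_m.+2) : j = 3 * i :> nat ->
    [set inl j; inr i] \in comb_edge @: [set: comb_label].
  move=> ji; apply/imsetP; exists (inr i) => //; apply/setP=> -[l|l].
    by rewrite !inE /= !(inj_eq (@inl_inj _ _)) -!val_eqE /= ji orbF.
  by rewrite !inE /= (inj_eq (@inr_inj _ _)).
apply/setP=> e; apply/imsetP/idP => [[[[j|i] [k|i']]]|/imsetP[[[g t]|i] _ ->]].
- by rewrite inE /= => /orP[]/eqP jk ->; [|rewrite setUC]; apply: gap.
- by rewrite inE /= => /eqP ji ->; apply: pend.
- by rewrite inE /= => /eqP ji ->; rewrite setUC; apply: pend.
- by rewrite inE.
- have jm1 : 3 * g + t <= 3 * m.+1 by have := ltn_ord g; have := ltn_ord t; lia.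
  have jm2 : (3 * g + t).+1 <= 3 * m.+1 by have := ltn_ord g; have := ltn_ord t; lia.
  exists (path_vertex jm1, path_vertex jm2); first by rewrite inE /= eqxx.
  by apply/setP=> -[l|l]; rewrite !inE /= ?(inj_eq (@inl_inj _ _)) -?val_eqE.
- have jm : 3 * i <= 3 * m.+1 by have := ltn_ord i; lia.
  exists (path_vertex jm, inr i); first by rewrite inE /=.
  apply/setP=> -[l|l]; rewrite !inE /= ?(inj_eq (@inl_inj _ _)).
    by rewrite orbF.
  by rewrite (inj_eq (@inr_inj _ _)).
Qed.


(** * Maximal packings and words of hub states *)

Lemma comb_packingP (L : {set comb_label}) :
  reflect ({in L &, forall k l, comb_conflict k l -> k = l} /\
           forall k, exists2 l, l \in L & comb_conflict k l)
    (maximal_packing comb_edge L).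
Proof.
apply: (iffP andP) => [[/forall_inP tL /forallP mL]|[tL mL]]; split.
- move=> k l kL lL; rewrite -comb_conflictE => kl.
  by have /forall_inP/(_ l lL)/implyP/(_ kl)/eqP := tL k kL.
- by move=> k; have /exists_inP[l lL] := mL k; rewrite comb_conflictE; exists l.
- apply/forall_inP=> k kL; apply/forall_inP=> l lL; apply/implyP.
  by rewrite comb_conflictE => /(tL _ _ kL lL) ->.
- apply/forallP=> k; have [l lL kl] := mL k.
  by apply/exists_inP; exists l; rewrite // comb_conflictE.
Qed.

(* Hub states: [None] is matched to the pendant vertex, [Some true] to the right,
   [Some false] to the left. *)
Definition word : finType := {ffun 'I_m.+2 -> option bool}.
Definition lhub (g : 'I_m.+1) : 'I_m.+2 := widen_ord (leqnSn _) g.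
Definition rhub (g : 'I_m.+1) : 'I_m.+2 := lift ord0 g.
Definition gap0 (g : 'I_m.+1) : comb_label := inl (g, @Ordinal 3 0 isT).
Definition gap1 (g : 'I_m.+1) : comb_label := inl (g, @Ordinal 3 1 isT).
Definition gap2 (g : 'I_m.+1) : comb_label := inl (g, @Ordinal 3 2 isT).

Definition word_ok (s : word) : bool :=
  (s ord0 != Some false) && (s ord_max != Some true).

Definition word_gap (s : word) g : bool :=
  (s (lhub g) != Some true) && (s (rhub g) != Some false).

Definition word_labels (s : word) : {set comb_label} :=
  [set l : comb_label | match l with
    | inr i => s i == None
    | inl (g, t) => match val t with
                    | 0 => s (lhub g) == Some true
                    | 1 => word_gap s g
                    | _ => s (rhub g) == Some false
                    end
    end].

(** Inverse of [word_labels] on maximal packings. [Some false] is the default when neither the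
    pendant nor the right edge is chosen; the test [i < m.+1] keeps [inord] in range, the last hub
    having no right edge. *)
Definition labels_word (L : {set comb_label}) : word :=
  [ffun i : 'I_m.+2 => if (inr i : comb_label) \in L then None
             else Some ((i < m.+1) && (gap0 (inord i) \in L))].

Lemma comb_label_ind (P : comb_label -> Prop) :
  (forall g, P (gap0 g)) -> (forall g, P (gap1 g)) -> (forall g, P (gap2 g)) ->
  (forall i, P (inr i)) -> forall l, P l.
Proof.
move=> P0 P1 P2 Pi [[g [[|[|[|t]]] lt]]|i] //.
- by rewrite (_ : inl _ = gap0 g) //; congr (inl (_, _)); apply: val_inj.
- by rewrite (_ : inl _ = gap1 g) //; congr (inl (_, _)); apply: val_inj.
- by rewrite (_ : inl _ = gap2 g) //; congr (inl (_, _)); apply: val_inj.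
Qed.

Lemma inord_lhub g : inord (lhub g) = g.
Proof. by apply: val_inj; rewrite /= inordK ?ltn_ord. Qed.

Lemma word_labelsK s : (labels_word (word_labels s) == s) = (s ord_max != Some true).
Proof.
apply/eqP/idP => [<-|smax].
  by rewrite ffunE; case: ifP => //; rewrite ltnn.
apply/ffunP=> i; rewrite ffunE inE; case: eqP => [->//|/eqP si].
have [im|im] := ltnP i m.+1; rewrite ?inE /=.
  rewrite (_ : lhub _ = i); last by apply: val_inj; rewrite /= inordK.
  by case: (s i) si => [[]|].
have <- : ord_max = i by apply: val_inj => /=; have := ltn_ord i; lia.
by move: si smax; rewrite (_ : i = ord_max); [case: (s _) => [[]|]|
  apply: val_inj => /=; have := ltn_ord i; lia].
Qed.

Lemma labels_wordK L : maximal_packing comb_edge L -> word_labels (labels_word L) = L.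
Proof.
case/comb_packingP=> tL mL.
have E0 g : (labels_word L (lhub g) == Some true) = (gap0 g \in L).
  rewrite ffunE inord_lhub (_ : lhub g < m.+1) /=; last exact: (ltn_ord g).
  case: ifP => [iL|_]; last by case: (_ \in L).
  by apply/esym/negP=> gL; have := tL _ _ iL gL; rewrite /= addn0 eqxx => /(_ isT).
have E2 g : (labels_word L (rhub g) == Some false) = (gap2 g \in L).
  rewrite ffunE; case: ifP => [iL|/negP iL].
    apply/esym/negP=> gL; have := tL _ _ iL gL; rewrite /= /bump /=.
    by rewrite (_ : _ || _ = true) ?orbT // => [/(_ isT)|]; last by lia.
  (* Maximality at the pendant edge covers the hub, so the left edge is the only option
     remaining. *)
  apply/eqP/idP=> [[/negbT gL]|gL].
    have [l lL] := mL (inr (rhub g)).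
    elim/comb_label_ind: l lL => [h|h|h|i] lL /=; rewrite ?/bump /=; try lia.
    - move=> e; case/negP: gL; have hg : h = g.+1 :> nat by lia.
      by rewrite /= /bump /= add1n -hg ltn_ord -[inord h]/(inord (lhub h)) inord_lhub.
    - by move=> e; rewrite (_ : g = h) //; apply: val_inj => /=; lia.
    - by move/eqP=> e; case: iL; rewrite e.
  congr Some; apply/negP=> /andP[lt hL]; have := tL _ _ gL hL.
  have -> : comb_conflict (gap2 g) (gap0 (inord (rhub g))).
    by rewrite /= inordK // /bump /=; lia.
  by move=> /(_ isT) [].
(* The middle edge meets only the two other edges of its gap, so it is present exactly when both are
   absent. *)
have E1 g : word_gap (labels_word L) g = (gap1 g \in L).
  rewrite /word_gap E0 E2; apply/andP/idP=> [[g0 g2]|gL].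
    have [l lL] := mL (gap1 g).
    elim/comb_label_ind: l lL => [h|h|h|i] lL /=; try lia.
    - move=> e; have hg : h = g by apply: val_inj => /=; lia.
      by rewrite hg (negbTE g0) in lL.
    - by move=> e; rewrite (_ : g = h) //; apply: val_inj => /=; lia.
    - move=> e; have hg : h = g by apply: val_inj => /=; lia.
      by rewrite hg (negbTE g2) in lL.
  split; apply/negP=> hL; have := tL _ _ gL hL;
    by rewrite /= (_ : _ && _ = true); [move/(_ isT)|lia].
apply/setP; elim/comb_label_ind => [g|g|g|i]; rewrite inE /= ?E0 ?E1 ?E2 //.
by rewrite ffunE; case: ifP.
Qed.

(** Every edge meeting the pendant edge at hub [i] contains that hub. *)
Lemma comb_conflict_hub i k l :
  comb_conflict (inr i) k -> comb_conflict (inr i) l -> comb_conflict k l.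
Proof.
case: k l => [[g t]|j] [[g' t']|j'] /=; try lia.
- by move=> ig /eqP <-.
- by move=> /eqP <-.
- by move=> /eqP <-.
Qed.

Lemma maximal_packing_word (s : word) : s ord_max != Some true ->
  maximal_packing comb_edge (word_labels s) = (s ord0 != Some false).
Proof.
move=> smax; apply/comb_packingP/idP => [[_ mL]|s0].
  (* The first hub has to be covered, and no edge leaves it to the left. *)
  have [l] := mL (inr ord0).
  elim/comb_label_ind: l => [g|g|g|i]; rewrite inE /=; try lia.
    move=> /eqP sg g0; rewrite (_ : ord0 = lhub g) ?sg //.
    by apply: val_inj => /=; lia.
  by move=> /eqP si /eqP ->; rewrite si.
split.
{
  move=> k l; elim/comb_label_ind: k => [g|g|g|i]; elim/comb_label_ind: l => [h|h|h|j];
    rewrite !inE /= ?addn0 => kL lL kl.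
  (* Two meeting labels are equal, or share a hub and require different states there, or include a
     middle edge that [word_gap] excludes. *)
  all: first
   [ by rewrite (_ : g = h) //; apply: val_inj => /=; lia
   | by rewrite (eqP kl)
   | by have e : g = h by [apply: val_inj => /=; lia]; rewrite /word_gap e in kL lL;
        case: (s _) kL lL => [[]|] //; case: (s _) => [[]|]
   | by have e : lhub g = rhub h by [apply: val_inj; rewrite /= /bump /=; lia];
        rewrite e in kL; case: (s _) kL lL => [[]|]
   | by have e : rhub g = lhub h by [apply: val_inj; rewrite /= /bump /=; lia];
        rewrite e in kL; case: (s _) kL lL => [[]|]
   | by have e : lhub g = j by [apply: val_inj; rewrite /=; lia];
        rewrite e in kL; case: (s _) kL lL => [[]|]
   | by have e : rhub g = j by [apply: val_inj; rewrite /= /bump /=; lia];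
        rewrite e in kL; case: (s _) kL lL => [[]|]
   | by have e : lhub h = i by [apply: val_inj; rewrite /=; lia];
        rewrite e in lL; case: (s _) kL lL => [[]|]
   | by have e : rhub h = i by [apply: val_inj; rewrite /= /bump /=; lia];
        rewrite e in lL; case: (s _) kL lL => [[]|]
   | lia ].
}
have hub i : exists2 l, l \in word_labels s & comb_conflict (inr i) l.
  case si: (s i) => [[]|].
  - have im : i < m.+1.
      rewrite ltn_neqAle -ltnS ltn_ord andbT; apply: contraNN smax => /eqP im.
      by rewrite (_ : ord_max = i) ?si //; apply: val_inj.
    have e : lhub (inord i) = i by apply: val_inj; rewrite /= inordK.
    by exists (gap0 (inord i)); rewrite ?inE /= ?e ?si // inordK // addn0 eqxx.
  - have i0 : 0 < i.
      rewrite lt0n; apply: contraNN s0 => /eqP i0.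
      by rewrite (_ : ord0 = i) ?si //; apply: val_inj.
    have e : rhub (inord i.-1) = i.
      by apply: val_inj; rewrite /= /bump /= inordK; have := ltn_ord i; lia.
    exists (gap2 (inord i.-1)); rewrite ?inE /= ?e ?si //.
    by rewrite inordK; have := ltn_ord i; lia.
  - by exists (inr i); rewrite ?inE /= ?si.
(* An edge through a hub meets the chosen edge covering that hub; only middle edges then need a
   separate argument. *)
have hubk i k : comb_conflict (inr i) k ->
    exists2 l, l \in word_labels s & comb_conflict k l.
  by move=> ik; have [l lL il] := hub i; exists l; rewrite // (comb_conflict_hub ik il).
move=> k; elim/comb_label_ind: k => [g|g|g|i].
- by apply: (hubk (lhub g)); rewrite /= addn0 eqxx.
- case wg: (word_gap s g).
    by exists (gap1 g); rewrite ?inE //= leqnSn.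
  case/nandP: (negbT wg) => /negPn sg; last first.
    by exists (gap2 g); rewrite ?inE //=; lia.
  by exists (gap0 g); rewrite ?inE //=; lia.
- by apply: (hubk (rhub g)); rewrite /= /bump /=; lia.
- exact: hub.
Qed.


(** The condition on the last hub comes from [word_labelsK], that on the first hub from
    [maximal_packing_word]. *)
Lemma sum_maximal_matching_comb (F : nat -> nat) :
  \sum_(M | @maximal_matching G M) F #|M| = \sum_(s | word_ok s) F #|word_labels s|.
Proof.
rewrite (sum_maximal_matching comb_edge_inj edges_comb).
rewrite (reindex_onto word_labels labels_word labels_wordK).
apply: eq_bigl => s; rewrite word_labelsK andbC /word_ok [RHS]andbC.
by apply: andb_id2l => /maximal_packing_word.
Qed.

(** * Counting admissible words and their edges *)

Lemma card_word_labels (s : word) : word_ok s ->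
  #|word_labels s| = m.+2 + \sum_g word_gap s g.
Proof.
case/andP=> s0 smax.
(* Each hub contributes one edge. Sums over gaps extend to all hubs because the missing terms, at
   the last and first hub, vanish by [word_ok]. *)
have hubs : \sum_g (s (lhub g) == Some true) + \sum_g (s (rhub g) == Some false) +
    \sum_i (s i == None) = m.+2.
  transitivity (\sum_(i < m.+2) ((s i == Some true) + (s i == Some false) + (s i == None))).
    rewrite !big_split /=; congr (_ + _ + _).
      by rewrite [RHS]big_ord_recr /= (negbTE smax) addn0.
    by rewrite [RHS]big_ord_recl (negbTE s0).
  rewrite (eq_bigr (fun=> 1)) ?sum1_card ?card_ord // => i _.
  by case: (s i) => [[]|].
rewrite -[in RHS]hubs -sum1_card big_mkcond big_sumType /=.
rewrite (eq_bigr (fun p => inl (p.1, p.2) \in word_labels s : nat)); last first.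
  by case=> g t _ /=; case: (_ \in _).
rewrite -(pair_bigA _ (fun g t => inl (g, t) \in word_labels s : nat)) /=.
under eq_bigr do rewrite !big_ord_recl big_ord0 addn0 !inE /=.
rewrite !big_split /= (eq_bigr (fun i => s i == None : nat)); last first.
  by move=> i _; rewrite inE; case: eqP.
by rewrite -!addnA; congr (_ + _); rewrite [LHS]addnC -addnA.
Qed.

(** Number of admissible states at a hub: pendant, right, left in this order. *)
Definition hub_card (i : 'I_m.+2) : nat := 1 + (i != ord_max) + (i != ord0).

Lemma card_word_ok : #|word_ok| = \prod_i hub_card i.
Proof.
pose Q i a := ~~ ((i == @ord0 m.+1) && (a == Some false)) &&
  ~~ ((i == @ord_max m.+1) && (a == Some true)).
transitivity #|[pred s : word | [forall i, Q i (s i)]]|.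
  apply: eq_card => s; rewrite [LHS]unfold_in [RHS]inE.
  apply/idP/forallP=> [/andP[s0 smax] i|sQ].
    by rewrite /Q; do 2?[case: eqVneq => [->|_] /=]; rewrite ?s0 ?smax //.
  have /andP[_] := sQ ord_max; have /andP[+ _] := sQ ord0.
  by rewrite !eqxx /word_ok /= => -> ->.
rewrite card_pointwise; apply: eq_bigr => i _.
by rewrite card_option_bool /Q /hub_card; case: (i == ord0); case: (i == ord_max).
Qed.

Lemma card_word_gap g :
  #|[pred s | word_ok s & word_gap s g]| =
  \prod_i (1 + ((i != ord_max) && (i != lhub g)) + ((i != ord0) && (i != rhub g))).
Proof.
pose Q i a := [&& ~~ ((i == @ord0 m.+1) && (a == Some false)),
  ~~ ((i == @ord_max m.+1) && (a == Some true)),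
  ~~ ((i == lhub g) && (a == Some true)) & ~~ ((i == rhub g) && (a == Some false))].
transitivity #|[pred s : word | [forall i, Q i (s i)]]|.
  apply: eq_card => s; rewrite !inE; apply/idP/forallP=> [|sQ].
    case/andP=> /andP[s0 smax] /andP[sl sr] i.
    by apply/and4P; split; case: eqVneq => //= ->.
  have /and4P[_ _ _] := sQ (rhub g); have /and4P[_ _ + _] := sQ (lhub g).
  have /and4P[_ + _ _] := sQ ord_max; have /and4P[+ _ _ _] := sQ ord0.
  by rewrite !eqxx /word_ok /word_gap /= => -> -> -> ->.
rewrite card_pointwise; apply: eq_bigr => i _.
rewrite card_option_bool /Q.
by case: (i == ord0); case: (i == ord_max); case: (i == lhub g); case: (i == rhub g).
Qed.

(** Only the factors at the two hubs of the gap change: from 3 * 3 to 2 * 2 in the interior, from 2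
    * 3 to 1 * 2 at an extreme gap. With [0 < m] no gap is both first and last. *)
Lemma card_word_gapE g : 0 < m ->
  9 * #|[pred s | word_ok s & word_gap s g]| =
  #|word_ok| * (if (g == ord0) || (g == ord_max) then 3 else 4).
Proof.
move=> m0; rewrite card_word_gap card_word_ok.
have rl : rhub g != lhub g by rewrite -val_eqE /= /bump /=; lia.
rewrite (bigD1 (lhub g)) //= (bigD1 (rhub g)) //=.
rewrite [X in _ = X * _](bigD1 (lhub g)) //= [X in _ = _ * X * _](bigD1 (rhub g)) //=.
have -> : \prod_(i < m.+2 | (i != lhub g) && (i != rhub g))
   (1 + ((i != ord_max) && (i != lhub g)) + ((i != ord0) && (i != rhub g))) =
  \prod_(i < m.+2 | (i != lhub g) && (i != rhub g)) hub_card i.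
  by apply: eq_bigr => i /andP[-> ->]; rewrite !andbT.
set p := bigop _ _ _; rewrite /hub_card.
have lm : lhub g != ord_max by rewrite -val_eqE /= neq_ltn ltn_ord.
have r0 : rhub g != ord0 by [].
have l0 : (lhub g == ord0) = (g == ord0) by [].
have rm : (rhub g == ord_max) = (g == ord_max) by [].
rewrite lm r0 l0 rm !eqxx (negbTE rl) (eq_sym (lhub g)) (negbTE rl) /=.
case: (eqVneq g ord0) => [->|_] /=.
  have -> : (ord0 == ord_max :> 'I_m.+1) = false by rewrite -val_eqE /=; lia.
  by rewrite /=; lia.
by case: eqP => _ /=; lia.
Qed.

(** * The invariants of the comb tree *)

Lemma nb_maximal_matchings_comb : nb_maximal_matchings G = #|word_ok|.
Proof.
rewrite /nb_maximal_matchings -!sum1_card.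
rewrite -(sum_maximal_matching_comb (fun=> 1)).
by apply: eq_bigl => M; rewrite inE.
Qed.

(** Exchanging the sums over words and gaps gives nine times the mean size: 9 (m + 2) + (4 m + 2) =
    13 m + 20. *)
Lemma sum_maximal_matchings_comb : 0 < m ->
  9 * sum_maximal_matchings G = #|word_ok| * (13 * m + 20).
Proof.
move=> m0; rewrite /sum_maximal_matchings (sum_maximal_matching_comb id).
rewrite (eq_bigr _ card_word_labels) big_split /= sum_nat_const exchange_big /=.
rewrite mulnDr big_distrr /=.
rewrite (eq_bigr (fun g => #|word_ok| * (if (g == ord0) || (g == ord_max) then 3 else 4))).
  rewrite -big_distrr /= sum_gap_weights // -[X in 9 * (X * _)]/(#|word_ok|).
  by move: #|word_ok| => T; lia.
move=> g _; rewrite -card_word_gapE //; congr (9 * _).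
transitivity (\sum_(s | word_ok s && word_gap s g) 1); last by rewrite -sum1_card.
by rewrite [RHS]big_mkcondr; apply: eq_bigr => s _; case: word_gap.
Qed.

Lemma matching_number_comb : matching_number G = 2 * m + 3.
Proof.
apply/eqP; rewrite eqn_leq; apply/andP; split.
  apply/bigmax_leqP=> M /matching_card_bound.
  by rewrite card_comb_tree; lia.
(* All pendant and all middle edges form a perfect matching, attaining half the number of
   vertices. *)
pose s : word := [ffun=> None].
have sok : word_ok s by rewrite /word_ok !ffunE.
have ms : matching (comb_edge @: word_labels s).
  have : maximal_matching (comb_edge @: word_labels s).
    rewrite (maximal_matching_lab comb_edge_inj edges_comb).
    by case/andP: sok => ? ?; rewrite maximal_packing_word.
  by case/maxsetP.
apply: leq_trans (leq_bigmax_cond _ ms).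
rewrite card_imset; last exact: comb_edge_inj.
rewrite card_word_labels // (eq_bigr (fun=> 1)) ?sum1_card ?card_ord; first by lia.
by move=> g _; rewrite /word_gap !ffunE.
Qed.

Lemma word_ok_gt0 : 0 < #|word_ok|.
Proof.
apply/card_gt0P; exists [ffun=> None].
by rewrite unfold_in !ffunE.
Qed.

End Comb.

(* The exact ratio and its limit *)
From mathcomp Require Import boolp classical_sets reals topology normedtype sequences.

Import Order.TTheory GRing.Theory Num.Theory.
Import numFieldNormedType.Exports.
Local Open Scope classical_set_scope.
Local Open Scope ring_scope.

Lemma matching_ratio_comb (R : realType) k :
  matching_ratio (comb_tree (k + 3)) R = 13 / 18 + 1 / 18 * (2 * k + 5)%:R^-1.
Proof.
rewrite addn3 /matching_ratio matching_number_comb nb_maximal_matchings_comb.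
rewrite (_ : (2 * k.+1 + 3 = 2 * k + 5)%N); last by lia.
have T0 : #|@word_ok k.+1|%:R != 0 :> R by rewrite pnatr_eq0 -lt0n word_ok_gt0.
have n0 : (2 * k + 5)%:R != 0 :> R by rewrite pnatr_eq0 addn_eq0 andbF.
have /(congr1 (fun x => x%:R : R)) := sum_maximal_matchings_comb (ltn0Sn k).
rewrite addn_eq0 andbF !natrM => T1.
have -> : (sum_maximal_matchings (comb_tree k.+3))%:R =
    #|@word_ok k.+1|%:R * (13 * k.+1 + 20)%:R / 9 :> R by rewrite -T1; field.
move: #|_|%:R T0 n0 => T T0.
have -> : (13 * k.+1 + 20)%:R = 13 * k%:R + 33 :> R.
  by rewrite mulnS addnC addnA natrD natrM addrC.
have -> : (2 * k + 5)%:R = 2 * k%:R + 5 :> R by rewrite natrD natrM.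
move=> n0.
by field; rewrite T0 n0.
Qed.

Theorem theorem11 (R : realType) :
  (fun n : nat => matching_ratio (comb_tree n) R) @ \oo --> (13 / 18 : R).
Proof.
(* The closed form holds from n = 3 on, hence the shift. *)
rewrite -(cvg_shiftn 3) (_ : (fun _ => _) =
  fun k => 13 / 18 + 1 / 18 * (2 * k + 5)%:R^-1); last first.
  by apply/funext => k; rewrite -matching_ratio_comb.
have {2}-> : 13 / 18 = 13 / 18 + 1 / 18 * 0 :> R by rewrite mulr0 addr0.
apply: cvgD; first exact: cvg_cst.
apply: cvgM; first exact: cvg_cst.
(* The inverse of 2 k + 5 lies between 0 and that of k + 1. *)
apply: squeeze_cvgr (cvg_cst _) cvg_harmonic; near=> k.
rewrite invr_ge0 ler0n /= lef_pV2 ?posrE ?ltr0n ?addn_gt0 ?orbT //.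
by rewrite ler_nat; lia.
Unshelve. all: by end_near.
Qed.
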